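(* Let $\mathbf p$ be an offspring distribution with $\mathbf p(0)+\mathbf p(1)<1$, with finite mean and $\mathbf p(0)>0$, and let $\mathbf q$ be a mark function such that $\mathbf p(k)\mathbf q(k)>0$ for some $k\in\mathbb N$. Let $\mathbb P$ be the distribution of the marked Galton-Watson tree with offspring distribution $\mathbf p$ and mark function $\mathbf q$. Let $s\in(0,1)$ and let $\kappa(s)$ be the unique fixed point in $[0,1]$ of $f_s(t)=\mathbb E[s^{M_1}t^{Z_1}]$. (1) For every $t\in[0,1]$, $n\in\mathbb N$ and $\Lambda_n\in\mathscr F_n$, $$\frac{\mathbb E[\mathbf 1_{\Lambda_n}s^{M_{n+p}}t^{Z_{n+p}}]}{\mathbb E[s^{M_{n+p}}t^{Z_{n+p}}]}\underset{p\to+\infty}{\longrightarrow}\mathbb E[\mathbf 1_{\Lambda_n}s^{M_n}\kappa(s)^{Z_n-1}].$$ (2) The probability measure $\mathbb Q_{s,1}$ on $(\mathbb T^*,\mathscr F)$ defined by $$\forall n\in\mathbb N,\ \forall\Lambda_n\in\mathscr F_n,\quad \mathbb Q_{s,1}(\Lambda_n)=\mathbb E\left[\mathbf 1_{\Lambda_n}s^{M_n}\kappa(s)^{Z_n-1}\right]$$ is the distribution of a marked Galton-Watson tree with reproduction-marking law $p_{s,0}$ given by $$p_{s,0}(k,\eta)=\mathbf p_0(k,\eta)\,s^\eta\,\kappa(s)^{k-1},\qquad k\in\mathbb N,\ \eta\in\{0,1\}.$$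
   Context: $\mathbb N=\{0,1,2,\dots\}$, $\mathbb N^*=\{1,2,\dots\}$. Let $\mathscr U=\bigcup_{n\ge0}(\mathbb N^* )^n$ be the set of finite sequences of positive integers, $|u|$ the length of $u$, $\emptyset$ the empty sequence. A tree $\mathbf t$ is a subset of $\mathscr U$ such that $\emptyset\in\mathbf t$; $uj\in\mathbf t\Rightarrow u\in\mathbf t$ (for $j\in\mathbb N^*$); and for each $u\in\mathbf t$ there is $k_u(\mathbf t)\in\mathbb N$ with $ui\in\mathbf t\iff i\le k_u(\mathbf t)$. A marked tree is $\mathbf t^*=(\mathbf t,(\eta_u)_{u\in\mathbf t})$ with $\eta_u\in\{0,1\}$; $\mathbb T^*$ is the set of marked trees. For $n\in\mathbb N$, $r_n^*(\mathbf t^* )$ is the marked tree consisting of the nodes $u\in\mathbf t$ with $|u|\le n$, keeping the marks of nodes with $|u|\le n-1$ and setting the marks at level $n$ to $0$. $\mathscr F_n$ is the $\sigma$-field on $\mathbb T^*$ generated by $r_n^*$, and $\mathscr F=\bigvee_n\mathscr F_n$. $Z_n(\mathbf t^* )$ is the number of nodes $u\in\mathbf t$ with $|u|=n$; $M_0=0$ and $M_n(\mathbf t^* )=\sum_{u\in\mathbf t,|u|\le n-1}\eta_u$ for $n\ge1$. For a probability distribution $\pi$ on $\mathbb N\times\{0,1\}$, the distribution of a marked Galton-Watson tree with reproduction-marking law $\pi$ is the unique probability measure $\mathbb P_\pi$ on $(\mathbb T^*,\mathscr F)$ such that, with $\tau^*$ the identity map of $\mathbb T^*$, for all $h\ge1$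 and $\mathbf t^*\in\mathbb T^*$, $\mathbb P_\pi(r_h^*(\tau^* )=r_h^*(\mathbf t^* ))=\prod_{u\in\mathbf t,|u|\le h-1}\pi(k_u(\mathbf t),\eta_u)$. An offspring distribution is a probability distribution $\mathbf p$ on $\mathbb N$; a mark function is a map $\mathbf q:\mathbb N\to[0,1]$. Set $\mathbf p_0(k,1)=\mathbf p(k)\mathbf q(k)$, $\mathbf p_0(k,0)=\mathbf p(k)(1-\mathbf q(k))$; the marked Galton-Watson tree with offspring distribution $\mathbf p$ and mark function $\mathbf q$ has distribution $\mathbb P=\mathbb P_{\mathbf p_0}$, with expectation $\mathbb E$, and $Z_n=Z_n(\tau^* )$, $M_n=M_n(\tau^* )$. Convention $0^0=1$. *)

(* Defs.v *)
From HB Require Import structures.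
From mathcomp Require Import all_boot all_order all_algebra finmap.
From mathcomp Require Import all_classical all_reals all_analysis.

Set Implicit Arguments.
Unset Strict Implicit.
Unset Printing Implicit Defensive.
Import Order.TTheory GRing.Theory Num.Theory.
Import numFieldNormedType.Exports.
Local Open Scope classical_set_scope.
Local Open Scope ring_scope.

(* The node u = (u_1, ..., u_n) is the sequence [:: u_1; ...; u_n], so that
   "uj" is rcons u j.  Letters range over nat, but the condition 0 < i below
   forces every letter of a node of a tree to be positive. *)
Definition is_tree (t : set (seq nat)) : Prop :=
  [/\ t [::],
      (forall u j, t (rcons u j) -> t u) &
      (forall u, t u -> exists k : nat, forall i : nat,
         t (rcons u i) <-> (0 < i <= k)%N)].

(* A mark is carried by the nodes only: mark is false outside nodes, so that
   equality of marked trees is equality of the nodes and of their marks. *)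
Record mtree : Type := MTree {
  nodes : set (seq nat);
  mark : seq nat -> bool;
  nodes_tree : is_tree nodes;
  mark_nodes : forall u, mark u -> nodes u }.

(* k_u(t); it is 0 when u is not a node of t. *)
Definition kids (t : mtree) (u : seq nat) : nat :=
  xget 0%N [set k | forall i : nat, nodes t (rcons u i) <-> (0 < i <= k)%N].

Section Restriction.
Variables (n : nat) (t : mtree).

Definition restr_nodes : set (seq nat) :=
  [set u | nodes t u /\ (size u <= n)%N].

Definition restr_mark (u : seq nat) : bool := mark t u && (size u < n)%N.

Lemma restr_nodes_tree : is_tree restr_nodes.
Proof.
have [t0 tp tk] := nodes_tree t; split.
- by split.
- by move=> u j [/tp tu]; rewrite size_rcons => /ltnW.
- move=> u [tu un]; have [un'|nu] := ltnP (size u) n.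
    have [k kP] := tk u tu; exists k => i; split.
      by move=> [/kP].
    by move=> /kP ti; split=> //; rewrite size_rcons.
  exists 0%N => i; split.
    by move=> [_]; rewrite size_rcons ltnNge nu.
  by rewrite leqn0; case: i.
Qed.

Lemma restr_mark_nodes u : restr_mark u -> restr_nodes u.
Proof. by move=> /andP[/mark_nodes tu /ltnW un]. Qed.

Definition restr : mtree := MTree restr_nodes_tree restr_mark_nodes.

End Restriction.

Definition Z (n : nat) (t : mtree) : nat :=
  #|` fset_set [set u | nodes t u /\ size u = n] |%fset.

Definition M (n : nat) (t : mtree) : nat :=
  \big[addn/0%N]_(u \in [set u | nodes t u /\ (size u < n)%N])
    nat_of_bool (mark t u).

(* The sigma-field generated by r_n^*: the range of r_n^* is countable and
   carries the discrete sigma-field. *)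
Definition F_ (n : nat) : set (set mtree) :=
  preimage_set_system setT (restr n) [set: set mtree].

Lemma mark_root (u : seq nat) : false -> [set ([::] : seq nat)] u.
Proof. by []. Qed.

Lemma root_tree : is_tree [set [::] : seq nat].
Proof.
split=> //.
- by move=> [|? ?] ? /=.
- move=> u _; exists 0%N => i; split; first by case: u.
  by rewrite leqn0; case: i.
Qed.

HB.instance Definition _ := gen_eqMixin mtree.
HB.instance Definition _ := gen_choiceMixin mtree.
HB.instance Definition _ :=
  isPointed.Build mtree (MTree root_tree (mark := fun=> false) mark_root).

(* The measurable space (T^*, F), where F is generated by all the F_n. *)
Definition mtreeF : measurableType _ :=
  g_sigma_algebraType (\bigcup_n F_ n).

Section Laws.
Variable R : realType.

Definition is_distribution (T : choiceType) (f : T -> R) : Prop :=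
  (forall x, 0 <= f x) /\ (\esum_(x in [set: T]) (f x)%:E = 1)%E.

Definition is_mgw (pi : nat * bool -> R) (P : probability mtreeF R) : Prop :=
  forall (h : nat) (t : mtree), (1 <= h)%N ->
    P [set x | restr h x = restr h t] =
    (\big[*%R/1]_(u \in [set u | nodes t u /\ (size u < h)%N])
       pi (kids t u, mark t u))%:E.

(* The law p_0 attached to the offspring distribution p and the mark
   function q; the mark 1 is true. *)
Definition mark_law (p q : nat -> R) (x : nat * bool) : R :=
  p x.1 * (if x.2 then q x.1 else 1 - q x.1).

Definition fgen (P : probability mtreeF R) (s t : R) : R :=
  fine 'E_P[fun x => s ^+ M 1 x * t ^+ Z 1 x].

(* The exponents Z_n - 1 and k - 1 may be equal to -1: these are integer
   powers. *)
Definition tilted_mean (P : probability mtreeF R) (s kappa : R) (n : nat)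
    (L : set mtree) : \bar R :=
  'E_P[fun x => \1_L x * s ^+ M n x * kappa ^ ((Z n x)%:Z - 1)].

Definition tilted_law (p q : nat -> R) (s kappa : R) (x : nat * bool) : R :=
  mark_law p q x * s ^+ x.2 * kappa ^ (x.1%:Z - 1).

End Laws.

(* Main.v *)
From HB Require Import structures.
Require Import Defs.
From mathcomp Require Import all_boot all_order all_algebra finmap.
From mathcomp Require Import all_classical all_reals all_analysis.
From mathcomp Require Import measurable_realfun ring lra.
Set Implicit Arguments.
Unset Strict Implicit.
Unset Printing Implicit Defensive.
Import Order.TTheory GRing.Theory Num.Theory.
Import numFieldNormedType.Exports.
Local Open Scope classical_set_scope.
Local Open Scope ring_scope.

(* Conditionally on the first n generations, the labels (k_u, eta_u) of the
   nodes at level n are independent with law p_0, hence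
     E[1_L s^M_(n+1) t^Z_(n+1)] = E[1_L s^M_n f(t)^Z_n]  for L in F_n,
   and by iteration E[1_L s^M_(n+m) t^Z_(n+m)] = E[1_L s^M_n f^m(t)^Z_n].
   Since f is monotone and convex with f(0) > 0 and f(1) < 1, the iterates
   f^m(t) converge to the fixed point kappa, which gives (1).  No extension
   theorem is needed for (2): the measure Q has the density
   lim_m s^M_m 0^Z_m / kappa with respect to P, which vanishes outside the
   extinction event; this limit is monotone, and (1) with t = 0 identifies its
   integral over L in F_n as the tilted mean of L. *)

(** * Marked trees and their restrictions *)

Definition level (n : nat) (t : mtree) : set (seq nat) :=
  [set u | nodes t u /\ size u = n].

Definition inner (n : nat) (t : mtree) : set (seq nat) :=
  [set u | nodes t u /\ (size u < n)%N].

Definition label (t : mtree) (u : seq nat) : nat * bool := (kids t u, mark t u).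

Lemma mtree_eq (x y : mtree) :
  nodes x = nodes y -> mark x = mark y -> x = y.
Proof.
case: x y => [n1 m1 p1 q1] [n2 m2 p2 q2] /= en em.
by subst; congr MTree; exact: Prop_irrelevance.
Qed.

(** If two bounds fitted, the child numbered by the larger one would be a node for one bound and not
    for the other; so whatever [xget] selects equals [k]. *)
Lemma kids_uniq (t : mtree) (u : seq nat) (k : nat) :
  (forall i, nodes t (rcons u i) <-> (0 < i <= k)%N) -> kids t u = k.
Proof.
move=> kP; rewrite /kids; case: xgetP => [l _ lP|/(_ k) []//].
apply/eqP; rewrite eqn_leq; apply/andP; split; rewrite leqNgt; apply/negP => lt.
- have : nodes t (rcons u l) by apply/lP; rewrite leqnn (leq_ltn_trans _ lt).
  by move=> /kP /andP[_]; rewrite leqNgt lt.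
- have : nodes t (rcons u k) by apply/kP; rewrite leqnn (leq_ltn_trans _ lt).
  by move=> /lP /andP[_]; rewrite leqNgt lt.
Qed.

Lemma kidsP (t : mtree) (u : seq nat) (i : nat) : nodes t u ->
  nodes t (rcons u i) <-> (0 < i <= kids t u)%N.
Proof.
move=> tu; have [_ _ /(_ u tu) [k kP]] := nodes_tree t.
by rewrite (kids_uniq kP).
Qed.

Lemma level0 (t : mtree) : level 0 t = [set [::]].
Proof.
apply/seteqP; split=> [u [_ /size0nil]//|u ->]; split=> //.
by have [] := nodes_tree t.
Qed.

Lemma inner0 (t : mtree) : inner 0 t = set0.
Proof. by apply/seteqP; split=> [u []|]. Qed.

(** Letters start at 1 while [I_(kids t u)] starts at 0, hence the shift [i.+1]. *)
Lemma levelS (n : nat) (t : mtree) :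
  level n.+1 t =
  \bigcup_(u in level n t) (fun i => rcons u i.+1) @` `I_(kids t u).
Proof.
have [_ tp _] := nodes_tree t; apply/seteqP; split=> [v [tv]|v].
  case/lastP: v tv => // u i tv; rewrite size_rcons => -[un].
  have tu := tp _ _ tv; exists u => //.
  move/(kidsP i tu): tv => /andP[i0 ik]; exists i.-1 => //=; last by rewrite prednK.
  by rewrite prednK.
move=> [u [tu un]] [i /= ik <-]; split; last by rewrite size_rcons un.
exact/kidsP.
Qed.

Lemma finite_level (n : nat) (t : mtree) : finite_set (level n t).
Proof.
elim: n => [|n IH]; first by rewrite level0.
rewrite levelS; apply: bigcup_finite => // u _.
exact/finite_image/finite_II.
Qed.

Lemma innerS (n : nat) (t : mtree) : inner n.+1 t = inner n t `|` level n t.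
Proof.
apply/seteqP; split=> [u [tu]|u [[tu un]|[tu un]]].
- by rewrite ltnS leq_eqVlt => /predU1P[|]; [right|left].
- by split=> //; exact: ltnW.
- by split=> //; rewrite un.
Qed.

Lemma finite_inner (n : nat) (t : mtree) : finite_set (inner n t).
Proof.
elim: n => [|n IH]; first by rewrite inner0.
by rewrite innerS finite_setU; split=> //; exact: finite_level.
Qed.

(** Stated for an arbitrary commutative monoid because it serves both the sum defining [M] and the
    product of the probabilities of the labels. *)
Lemma big_innerS (S : Type) (idx : S) (op : Monoid.com_law idx) (n : nat)
    (t : mtree) (F : seq nat -> S) :
  \big[op/idx]_(u \in inner n.+1 t) F u =
  op (\big[op/idx]_(u \in inner n t) F u)
     (\big[op/idx]_(u <- fset_set (level n t)) F u).
Proof.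
rewrite -fsbig_finite; last exact: finite_level.
rewrite innerS.
rewrite fsbigU//; [exact: finite_inner|exact: finite_level|].
by move=> u [[_ lt] [_ eq]]; move: lt; rewrite eq ltnn.
Qed.

Lemma M0 (t : mtree) : M 0 t = 0%N.
Proof. by rewrite /M -/(inner 0 t) inner0 fsbig_set0. Qed.

Lemma MS (n : nat) (t : mtree) :
  M n.+1 t = (M n t + \sum_(u <- fset_set (level n t)) mark t u)%N.
Proof. exact: big_innerS. Qed.

Lemma Z0 (t : mtree) : Z 0 t = 1%N.
Proof. by rewrite /Z -/(level 0 t) level0 fset_set1 cardfs1. Qed.

Lemma ZS (n : nat) (t : mtree) :
  Z n.+1 t = (\sum_(u <- fset_set (level n t)) kids t u)%N.
Proof.
rewrite /Z -/(level n.+1 t).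
set s := fset_set (level n t).
(* [r] enumerates generation n+1 parent by parent; [rcons] is injective, so nothing is repeated. *)
pose r := [seq rcons u i.+1 | u <- s, i <- iota 0 (kids t u)].
have -> : #|` fset_set (level n.+1 t)| = size r.
  apply/perm_size/uniq_perm; first exact: fset_uniq.
    apply: allpairs_uniq_dep; [exact: fset_uniq|by move=> u _; exact: iota_uniq|].
    by move=> [u i] [v j] _ _ /= /eqP; rewrite eqseq_rcons => /andP[/eqP-> /eqP[->]].
  move=> v; rewrite in_fset_set; last exact: finite_level.
  apply/idP/allpairsPdep => [|[u [i [us ik ->]]]].
    rewrite inE levelS => -[u lu [i /= ik <-]]; exists u, i; split=> //.
      by rewrite in_fset_set ?inE//; exact: finite_level.
    by rewrite mem_iota add0n.
  rewrite inE levelS; exists u; last by exists i => //; move: ik; rewrite mem_iota add0n.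
  by move: us; rewrite in_fset_set ?inE//; exact: finite_level.
rewrite size_allpairs_dep sumnE big_map; apply: eq_bigr => u _.
by rewrite size_iota.
Qed.

Lemma mem_level (n : nat) (t : mtree) (u : seq nat) :
  (u \in fset_set (level n t)) = (u \in level n t).
Proof. by rewrite in_fset_set//; exact: finite_level. Qed.

Lemma level_restr (n m : nat) (t : mtree) : (n <= m)%N ->
  level n (restr m t) = level n t.
Proof.
move=> nm; apply/seteqP; split=> [u [[]]|u [tu un]]//.
by split=> //; split=> //; rewrite un.
Qed.

Lemma inner_restr (n m : nat) (t : mtree) : (n <= m)%N ->
  inner n (restr m t) = inner n t.
Proof.
move=> nm; apply/seteqP; split=> [u [[]]|u [tu un]]//.
by split=> //; split=> //; rewrite (leq_trans (ltnW un)).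
Qed.

Lemma restrK (n m : nat) (t : mtree) : (n <= m)%N ->
  restr n (restr m t) = restr n t.
Proof.
move=> nm; apply: mtree_eq.
  apply/seteqP; split=> u /=; first by move=> [[]].
  by move=> [tu un]; split=> //; split=> //; exact: leq_trans nm.
apply/funext => u /=; rewrite /restr_mark/= /restr_mark -andbA; congr andb.
by case: (ltnP (size u) n) => [/leq_trans->|]; rewrite ?andbF.
Qed.

Lemma restr_le (n m : nat) (x y : mtree) : (n <= m)%N ->
  restr m x = restr m y -> restr n x = restr n y.
Proof. by move=> nm e; rewrite -(restrK x nm) e restrK. Qed.

(** Only the unmarked root survives at depth 0. This makes F_0 trivial and supplies the case h = 0,
    which [is_mgw] leaves out. *)
Lemma restr0_eq (x y : mtree) : restr 0 x = restr 0 y.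
Proof.
have [[x0 _ _] [y0 _ _]] := (nodes_tree x, nodes_tree y).
apply: mtree_eq; apply/funext => u /=.
  by apply/propext; split=> -[_]; rewrite leqn0 => /nilP ->.
by rewrite /restr_mark ltn0 !andbF.
Qed.

Lemma restr_nodes_lt (n : nat) (x y : mtree) (u : seq nat) :
  restr n x = restr n y -> (size u <= n)%N -> nodes x u <-> nodes y u.
Proof.
move=> /(congr1 (nodes^~ u)) /= e un; split=> xu.
- by suff [] : nodes (restr n y) u by []; rewrite /= -e.
- by suff [] : nodes (restr n x) u by []; rewrite /= e.
Qed.

Lemma kids_notin (t : mtree) (u : seq nat) : ~ nodes t u -> kids t u = 0%N.
Proof.
move=> tu; apply: kids_uniq => i; have [_ tp _] := nodes_tree t.
by split=> [/tp//|]; case: i.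
Qed.

(** The children of a node of length below n have length at most n, so they survive the restriction,
    as does the mark of the node. Outside the tree both offspring numbers are 0. *)
Lemma label_restr (n : nat) (t : mtree) (u : seq nat) :
  (size u < n)%N -> label (restr n t) u = label t u.
Proof.
move=> un; congr pair; last by rewrite /= /restr_mark un andbT.
have [tu|tu] := pselect (nodes t u); last by rewrite !kids_notin// => -[].
apply: kids_uniq => i; split=> [[/kidsP->//]|/kidsP ti].
by split; [exact: ti|rewrite size_rcons].
Qed.

Lemma label_restr_eq (n : nat) (x y : mtree) (u : seq nat) :
  restr n x = restr n y -> (size u < n)%N -> label x u = label y u.
Proof. by move=> e un; rewrite -(label_restr x un) e label_restr. Qed.

Lemma Z_restr (n m : nat) (t : mtree) : (n <= m)%N -> Z n (restr m t) = Z n t.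
Proof. by move=> nm; rewrite /Z -/(level n t) -(level_restr t nm). Qed.

Lemma M_restr (n m : nat) (t : mtree) : (n <= m)%N -> M n (restr m t) = M n t.
Proof.
move=> nm; rewrite /M -/(inner n t) -/(inner n (restr m t)) inner_restr//.
apply: eq_fsbigr => u; rewrite inE => -[tu un].
by rewrite /= /restr_mark (leq_trans un nm) andbT.
Qed.

(* The tree restr n t in which the nodes at level n get the offspring numbers
   and the marks prescribed by a. *)
Section Grow.
Variables (n : nat) (t : mtree) (a : seq nat -> nat * bool).

Definition grow_nodes : set (seq nat) :=
  [set v | (nodes t v /\ (size v <= n)%N) \/
    exists2 u, level n t u & exists2 i, (0 < i <= (a u).1)%N & v = rcons u i].

Definition grow_mark (u : seq nat) : bool :=
  if (size u < n)%N then mark t u else (u \in level n t) && (a u).2.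

Lemma grow_nodes_rcons (u : seq nat) (i : nat) : level n t u ->
  grow_nodes (rcons u i) <-> (0 < i <= (a u).1)%N.
Proof.
move=> [tu un]; split=> [[[]|[v _ [j jk /eqP]]]|ik].
- by rewrite size_rcons un ltnn.
- by rewrite eqseq_rcons => /andP[/eqP-> /eqP->].
- by right; exists u => //; exists i.
Qed.

Lemma grow_tree : is_tree grow_nodes.
Proof.
have [t0 tp tk] := nodes_tree t; split.
- by left.
- move=> u j [[/tp tu]|[v [tv vn] [i _ /eqP]]].
    by rewrite size_rcons => /ltnW; left.
  by rewrite eqseq_rcons => /andP[/eqP-> _]; left; rewrite vn.
- move=> u [[tu]|[v [tv vn] [i _ ->]]]; last first.
    (* A node added at level n+1 is a leaf: a child of it would have length n+2. *)
    exists 0%N => j; split; last by case: j.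
    case=> [[_]|[w [_ wn] [k _ /eqP]]].
      by rewrite !size_rcons vn ltnNge leqnSn.
    rewrite eqseq_rcons => /andP[/eqP wE _].
    by move: wn; rewrite -wE size_rcons vn => /eqP; rewrite eqn_leq ltnn.
  rewrite leq_eqVlt => /predU1P[un|un].
    by exists (a u).1 => i; apply: grow_nodes_rcons.
  exists (kids t u) => i; rewrite -(kidsP i tu); split=> [[[]//|]|ti].
    move=> [v [_ vn] [j _ /eqP]]; rewrite eqseq_rcons => /andP[/eqP uv _].
    by move: un; rewrite uv vn ltnn.
  by left; rewrite size_rcons.
Qed.

Lemma grow_mark_nodes (u : seq nat) : grow_mark u -> grow_nodes u.
Proof.
rewrite /grow_mark; case: ltnP => [un /mark_nodes tu|_ /andP[]].
  by left; split=> //; exact: ltnW.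
by rewrite inE => -[tu un] _; left; rewrite un.
Qed.

Definition grow : mtree := MTree grow_tree grow_mark_nodes.

Lemma restr_grow : restr n grow = restr n t.
Proof.
apply: mtree_eq => /=.
  apply/seteqP; split=> [v [[[]//|]]|v [tv vn]].
    by move=> [u [_ un] [i _ ->]]; rewrite size_rcons un ltnn.
  by split=> //; left.
apply/funext => u; rewrite /restr_mark /= /grow_mark.
by case: ltnP; rewrite ?andbF.
Qed.

Lemma label_grow (u : seq nat) : level n t u -> label grow u = a u.
Proof.
move=> lu; rewrite [RHS]surjective_pairing; congr pair.
  by apply: kids_uniq => i; exact: grow_nodes_rcons.
by case: (lu) => _ un; rewrite /= /grow_mark un ltnn mem_set.
Qed.

End Grow.

(** What r_(n+1) sees beyond r_n is exactly the labels at level n: the offspring numbers determine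
    the nodes at level n+1, and the marks at level n are those that r_n erases. *)
Lemma restrS_eq (n : nat) (x y : mtree) :
  restr n.+1 x = restr n.+1 y <->
  restr n x = restr n y /\ {in level n y, label x =1 label y}.
Proof.
split=> [e|[e lxy]].
  split=> [|u]; first exact: restr_le e.
  rewrite inE => -[yu un].
  by apply: label_restr_eq e _; rewrite un.
have nxy u : (size u <= n)%N -> nodes x u <-> nodes y u by exact: restr_nodes_lt.
have ny u i : nodes y u -> size u = n -> nodes x (rcons u i) <-> nodes y (rcons u i).
  move=> yu un; have xu : nodes x u by apply/nxy; rewrite ?un.
  rewrite !kidsP//.
  by have /(congr1 fst)/= -> : label x u = label y u by apply: lxy; rewrite inE.
have [_ xp _] := nodes_tree x; have [_ yp _] := nodes_tree y.
apply: mtree_eq => /=.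
  apply/seteqP; split=> u [tu]; rewrite leq_eqVlt ltnS => /predU1P[un|un];
    split; rewrite ?un// ?(leqW un)//; try by apply/nxy.
  - case/lastP: u tu un => // u i tu; rewrite size_rcons => -[un].
    by apply/ny => //; apply/nxy; rewrite ?un//; exact: xp tu.
  - case/lastP: u tu un => // u i tu; rewrite size_rcons => -[un].
    by apply/ny => //; exact: yp tu.
apply/funext => u; rewrite /restr_mark ltnS leq_eqVlt andb_orr [RHS]andb_orr.
congr orb; last by move/(congr1 (mark^~ u)): e.
case: eqP => [un|]; rewrite ?andbF// !andbT.
have [yu|yu] := pselect (nodes y u).
  by have /(congr1 snd) : label x u = label y u by apply: lxy; rewrite inE.
have xu : ~ nodes x u by move=> /nxy; rewrite un => /(_ (leqnn _)).
by apply/idP/idP => /mark_nodes.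
Qed.

(** A restricted tree is encoded by the finite set of its nodes paired with their marks, and such
    finite sets form a countable type. The nodes of length at most n are [inner n.+1]. *)
Lemma countable_range_restr (n : nat) : countable (range (restr n)).
Proof.
pose code (x : mtree) : {fset seq nat * bool} :=
  [fset (u, mark x u) | u in fset_set (inner n.+1 x)]%fset.
apply/pcard_injP; exists (choice.pickle \o code) => _ _ /set_mem[x _ <-] /set_mem[y _ <-].
move=> /(pcan_inj choice.pickleK) /fsetP e.
have codeP z u b : ((u, b) \in code (restr n z)) =
    (u \in inner n.+1 z) && (b == mark (restr n z) u).
  have fi k w : finite_set (inner k w) by exact: finite_inner.
  apply/imfsetP/andP => [[v /=]|[uz /eqP->]].
    rewrite in_fset_set// inE => -[[zv vn] _] [-> ->].
    by rewrite inE; split.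
  exists u => //=; rewrite in_fset_set// inE.
  by move: uz; rewrite inE => -[zu un]; split.
have nE z u : nodes (restr n z) u <-> u \in inner n.+1 z.
  by rewrite inE; split=> -[].
have inn u : nodes (restr n x) u <-> nodes (restr n y) u.
  rewrite !nE; split=> h.
  - have := e (u, mark (restr n x) u).
    by rewrite !codeP h eqxx => /esym/andP[].
  - have := e (u, mark (restr n y) u).
    by rewrite !codeP h eqxx => /andP[].
apply: mtree_eq.
  by apply/seteqP; split=> u /inn.
apply/funext => u.
have [xu|xu] := pselect (nodes (restr n x) u).
  have /nE xu' := xu; have := e (u, mark (restr n x) u).
  by rewrite !codeP xu' eqxx => /esym/andP[_ /eqP].
have yu : ~ nodes (restr n y) u by move=> /inn.
by apply/idP/idP => /mark_nodes.
Qed.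

(** * The branching property *)

Lemma F_P (n : nat) (L : set mtree) :
  F_ n L <-> forall x y, restr n x = restr n y -> L x -> L y.
Proof.
split=> [[B _ <-] x y e [_]|Lxy]; first by rewrite /preimage/= e.
exists (restr n @` L) => //; rewrite setTI; apply/seteqP.
by split=> [x [y Ly /esym e]|x Lx]; [exact: Lxy Ly|exists x].
Qed.

Lemma F_le (n m : nat) (L : set mtree) : (n <= m)%N -> F_ n L -> F_ m L.
Proof.
by move=> nm /F_P Lxy; apply/F_P => x y /(restr_le nm); exact: Lxy.
Qed.

Lemma F_setI (n : nat) (A B : set mtree) : F_ n A -> F_ n B -> F_ n (A `&` B).
Proof.
move=> /F_P Axy /F_P Bxy; apply/F_P => x y e [Ax Bx].
by split; [exact: Axy Ax|exact: Bxy Bx].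
Qed.

Lemma F_measurable (n : nat) (L : set mtree) : F_ n L ->
  measurable (L : set mtreeF).
Proof. by move=> FL; apply: sub_sigma_algebra; exists n. Qed.

Lemma F_label (n : nat) (u : seq nat) (c : nat * bool) :
  (size u < n)%N -> F_ n [set x | label x u = c].
Proof. by move=> un; apply/F_P => x y /label_restr_eq/= ->. Qed.

Lemma measurable_label (u : seq nat) (c : nat * bool) :
  measurable ((label^~ u : mtreeF -> nat * bool) @^-1` [set c]).
Proof. by apply: (@F_measurable (size u).+1); exact: F_label. Qed.

Lemma F_atom (n : nat) (t : mtree) : F_ n [set x | restr n x = restr n t].
Proof. by apply/F_P => x y /= <-. Qed.

Lemma measurable_atom (n : nat) (t : mtree) :
  measurable ([set x | restr n x = restr n t] : set mtreeF).
Proof. exact: F_measurable (F_atom n t). Qed.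

(* For a function f this amounts to being F_n-measurable. *)
Definition restr_inv (n : nat) (S : Type) (f : mtree -> S) : Prop :=
  forall x y, restr n x = restr n y -> f x = f y.

(** All preimages under an invariant map lie in F_n, so measurability of anything that depends on
    finitely many generations reduces to invariance. *)
Lemma restr_inv_measurable (n : nat) d (S : measurableType d) (f : mtree -> S)
    (D : set mtreeF) :
  restr_inv n f -> measurable_fun D (f : mtreeF -> S).
Proof.
move=> fn; apply: (@measurable_funS _ _ _ _ setT) => //.
move=> _ B mB; rewrite setTI; apply: (@F_measurable n).
by apply/F_P => x y /fn; rewrite /preimage/= => ->.
Qed.

Lemma restr_inv_level (n : nat) : restr_inv n (level n).
Proof.
by move=> x y e; rewrite -(level_restr x (leqnn n)) e level_restr.
Qed.

Lemma restr_inv_inner (n : nat) : restr_inv n (inner n).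
Proof.
by move=> x y e; rewrite -(inner_restr x (leqnn n)) e inner_restr.
Qed.

Lemma restr_inv_Z (n : nat) : restr_inv n (Z n).
Proof. by move=> x y e; rewrite -(Z_restr x (leqnn n)) e Z_restr. Qed.

Lemma restr_inv_M (n : nat) : restr_inv n (M n).
Proof. by move=> x y e; rewrite -(M_restr x (leqnn n)) e M_restr. Qed.

Lemma restr_inv_indic (R : realType) (n : nat) (L : set mtree) : F_ n L ->
  restr_inv n (\1_L : mtree -> R).
Proof.
move=> /F_P Lxy x y e; rewrite !indicE; congr (_%:R); congr nat_of_bool.
by apply/idP/idP; rewrite !inE; apply: Lxy.
Qed.

(** Splits an integral along the values of [c]; used below with [c] a label of a node or a code of a
    restricted tree. *)
Lemma integral_partition d (T : measurableType d) (R : realType)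
    (mu : {measure set T -> \bar R}) (C : countType) (c : T -> C) (D : set T)
    (f : T -> \bar R) :
  measurable D -> (forall i, measurable (c @^-1` [set i])) ->
  measurable_fun D f -> (forall x, D x -> 0 <= f x)%E ->
  (\int[mu]_(x in D) f x =
   \esum_(i in [set: C]) \int[mu]_(x in D `&` c @^-1` [set i]) f x)%E.
Proof.
move=> mD mc mf f0.
pose Fi i := D `&` (choice.pickle \o c) @^-1` [set i].
have FE j : Fi (choice.pickle j) = D `&` c @^-1` [set j].
  by congr setI; apply/seteqP; split=> x /= => [/(pcan_inj choice.pickleK)|->].
have F0 i : (forall j : C, choice.pickle j <> i) -> Fi i = set0.
  by move=> h; apply/seteqP; split=> // x [_ /h].
have DE : D = \bigcup_i Fi i.
  by apply/seteqP; split=> [x Dx|x [i _ []//]]; exists (choice.pickle (c x)).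
rewrite {1}DE ge0_integral_bigcup.
- rewrite nneseries_esumT; last first.
    by move=> i; apply: integral_ge0 => x [Dx _]; exact: f0.
  (* Indices that are not codes of elements of [C] give empty cells and contribute 0. *)
  rewrite (esumID (range (@choice.pickle C))); last first.
    by move=> i _; apply: integral_ge0 => x [Dx _]; exact: f0.
  rewrite [X in (_ + X)%E]esum1 ?adde0; last first.
    by move=> i [_ h]; rewrite F0 ?integral_set0// => j ji; apply: h; exists j.
  rewrite setTI esum_image; last by move=> i j _ _ /(pcan_inj choice.pickleK).
  by apply: eq_esum => j _; rewrite FE.
- move=> i; have [[j <-]|h] := pselect (exists j : C, choice.pickle j = i).
    by rewrite FE; exact: measurableI.
  by rewrite F0// => j ji; apply: h; exists j.
- by rewrite -DE.
- by rewrite -DE.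
- by move=> i j _ _ [x [[_ <-] [_ <-]]].
Qed.

Section Step.
Variables (R : realType) (pi : nat * bool -> R) (P : probability mtreeF R).
Hypotheses (pi_ge0 : forall c, 0 <= pi c) (P_mgw : is_mgw pi P).

Lemma atom_prob (n : nat) (t : mtree) :
  P [set x | restr n x = restr n t] =
  (\big[*%R/1]_(u \in inner n t) pi (label t u))%:E.
Proof.
case: n => [|n]; last exact: P_mgw.
rewrite inner0 fsbig_set0 -(@probability_setT _ _ _ P); congr (P _).
by apply/seteqP; split=> // x _; exact: restr0_eq.
Qed.

(** The event is a single atom of F_(n+1), that of the grown tree, and the product over [inner n.+1]
    splits off the level n. This is the independence of the labels at level n, given the first n
    generations. *)
Lemma grow_prob (n : nat) (t : mtree) (a : seq nat -> nat * bool) :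
  P [set x | restr n x = restr n t /\ {in level n t, label x =1 a}] =
  (\big[*%R/1]_(u \in inner n t) pi (label t u) *
   \prod_(u <- fset_set (level n t)) pi (a u))%:E.
Proof.
set y := grow n t a.
have lE : level n y = level n t by apply/restr_inv_level/restr_grow.
have iE : inner n y = inner n t by apply/restr_inv_inner/restr_grow.
have yP u : u \in level n t -> label y u = a u by move=> /set_mem/label_grow->.
have -> : [set x | restr n x = restr n t /\ {in level n t, label x =1 a}] =
    [set x | restr n.+1 x = restr n.+1 y].
  apply/seteqP; split=> x /=; rewrite restrS_eq restr_grow lE => -[-> h].
    by split=> // u ul; rewrite h// yP.
  by split=> // u ul; rewrite h// yP.
rewrite atom_prob big_innerS iE lE; congr (_ * _)%:E.
  apply: eq_fsbigr => u; rewrite inE => -[_ un].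
  by rewrite (label_restr_eq (restr_grow n t a)).
by apply: eq_big_seq => u; rewrite mem_level => /yP ->.
Qed.

(** The root label has law [pi]: this is [grow_prob] at n = 0, summed over the values of the
    label. *)
Lemma integral_root_label (g : nat * bool -> R) : (forall c, 0 <= g c) ->
  (\int[P]_x (g (label x [::]))%:E =
   \esum_(c in [set: nat * bool]) (pi c * g c)%:E)%E.
Proof.
move=> g0; rewrite (@integral_partition _ _ _ P _ (label^~ [::])) //.
- apply: eq_esum => c _; rewrite setTI.
  rewrite (eq_integral (cst (g c)%:E)); last first.
    by move=> x; rewrite inE/= => ->.
  rewrite integral_cst; last exact: measurable_label.
  have := grow_prob 0 point (fun=> c).
  rewrite inner0 fsbig_set0 level0 fset_set1 big_seq_fset1 mul1r EFinM muleC => <-.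
  congr (P _ * _)%E; apply/seteqP; split=> x /=.
    by move=> xc; split=> [|u]; [exact: restr0_eq|rewrite inE => ->].
  by move=> [_]; apply; rewrite inE.
- by move=> c; exact: measurable_label.
- by apply: (@restr_inv_measurable 1) => x y /label_restr_eq ->.
- by move=> x _; rewrite lee_fin.
Qed.

(* Reveals the labels of the nodes at level n one at a time: us1 lists the
   nodes whose label is already known. *)
Lemma integral_revealed (g : nat * bool -> R) (r : R) (n : nat) (t : mtree)
    (us2 us1 : seq (seq nat)) (a : seq nat -> nat * bool) :
  (forall c, 0 <= g c) -> (\int[P]_x (g (label x [::]))%:E = r%:E)%E ->
  us1 ++ us2 = fset_set (level n t) ->
  (\int[P]_(x in [set x | restr n x = restr n t /\ {in us1, label x =1 a}])
     (\prod_(u <- us2) g (label x u))%:E =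
   (\big[*%R/1]_(u \in inner n t) pi (label t u) *
    \prod_(u <- us1) pi (a u) * r ^+ size us2)%:E)%E.
Proof.
move=> g0 gr; elim: us2 us1 a => [|u us2 IH] us1 a usE.
  (* All labels are revealed: the integrand is 1 and the probability of the event is given by
     [grow_prob]. *)
  rewrite cats0 in usE; subst us1.
  under eq_integral do rewrite big_nil.
  rewrite expr0 mulr1 -grow_prob integral_cst ?mul1e; last first.
    apply: (@F_measurable n.+1); apply: F_setI; first exact/(F_le _ (F_atom _ _)).
    apply/F_P => x y e /= xa v vl; rewrite -xa//; apply: label_restr_eq (esym e) _.
    by move: vl; rewrite mem_level inE => -[_ ->].
  congr (P _); apply/seteqP; split=> x /= [-> h]; split=> // v vl; apply: h.
    by rewrite mem_level.
  by rewrite -mem_level.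
set E := [set x | _].
have us_level v : v \in us1 ++ u :: us2 -> size v = n.
  by rewrite usE mem_level inE => -[].
have FE : F_ n.+1 E.
  apply: F_setI; first exact/(F_le _ (F_atom _ _)).
  apply/F_P => x y e /= xa v vl; rewrite -xa//; apply: label_restr_eq (esym e) _.
  by rewrite us_level// mem_cat vl.
have un : size u = n by rewrite us_level// mem_cat mem_head orbT.
have prod_inv vs : {subset vs <= us1 ++ u :: us2} ->
    restr_inv n.+1 (fun x => (\prod_(u <- vs) g (label x u))%:E).
  move=> vsP x y e; congr EFin; apply: eq_big_seq => v vl.
  by rewrite (label_restr_eq e)// us_level// vsP.
have u_us1 : u \notin us1.
  have : uniq (us1 ++ u :: us2) by rewrite usE fset_uniq.
  by rewrite cat_uniq => /and3P[_ /hasPn/(_ u)]; rewrite mem_head => ->.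
rewrite (@integral_partition _ _ _ P _ (label^~ u)); first last.
- by move=> x _; rewrite lee_fin; apply: prodr_ge0.
- by apply: (@restr_inv_measurable n.+1); apply: prod_inv => v vl; rewrite mem_cat vl orbT.
- by move=> c; exact: measurable_label.
- exact: F_measurable FE.
set K := \big[_/_]_(u \in _) _; set K1 := \prod_(u <- us1) _.
have K0 : 0 <= K by rewrite -lee_fin -atom_prob measure_ge0.
have K10 : 0 <= K1 by exact: prodr_ge0.
have r0 : 0 <= r by rewrite -lee_fin -gr; apply: integral_ge0 => x _; rewrite lee_fin.
pose k := K * K1 * r ^+ size us2.
have k0 : 0 <= k by rewrite !mulr_ge0// exprn_ge0.
(* Splitting on the label c of [u], the induction hypothesis gives [pi c * (k * g c)]; summing over
   c then restores the mean r of [g] at the root and provides the missing factor. *)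
transitivity (\esum_(c in [set: nat * bool]) (pi c * (k * g c))%:E)%E.
  apply: eq_esum => c _.
  (* [a'] records the newly revealed label; it agrees with [a] on [us1] because the enumeration of
     the level has no repetition. *)
  pose a' v := if v == u then c else a v.
  have a'E v : v \in us1 -> a' v = a v.
    by move=> vl; rewrite /a'; case: eqP => // vu; rewrite -vu vl in u_us1.
  have -> : E `&` label^~ u @^-1` [set c] =
      [set x | restr n x = restr n t /\ {in rcons us1 u, label x =1 a'}].
    apply/seteqP; split=> x /=.
      move=> [[e xa] xu]; split=> // v; rewrite mem_rcons inE => /predU1P[->|vl].
        by rewrite /a' eqxx.
      by rewrite a'E// xa.
    move=> [e xa]; split; last by rewrite xa ?mem_rcons ?mem_head// /a' eqxx.
    by split=> // v vl; rewrite xa ?a'E// mem_rcons inE vl orbT.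
  under eq_integral.
    move=> x; rewrite inE => -[_ xa].
    rewrite big_cons xa ?mem_rcons ?mem_head// /a' eqxx EFinM; over.
  rewrite ge0_integralZl; first last.
  - by rewrite lee_fin.
  - by move=> x _; rewrite lee_fin; apply: prodr_ge0.
  - apply: (@restr_inv_measurable n.+1); apply: prod_inv => v vl.
    by rewrite mem_cat inE vl !orbT.
  - apply: (@F_measurable n.+1); apply: F_setI; first exact/(F_le _ (F_atom _ _)).
    apply/F_P => x y e /= xa v vl; rewrite -xa//; apply: label_restr_eq (esym e) _.
    by rewrite us_level//; move: vl; rewrite mem_rcons mem_cat !inE orbA orbC => ->.
  rewrite IH ?cat_rcons//; rewrite -EFinM; congr EFin.
  rewrite -cats1 big_cat big_seq1/= {2}/a' eqxx.
  rewrite (eq_big_seq _ (fun v vl => congr1 pi (a'E v vl))).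
  rewrite -/K -/K1 /k; ring.
rewrite -integral_root_label; last by move=> c; rewrite mulr_ge0.
under eq_integral do rewrite EFinM.
rewrite ge0_integralZl//.
- by rewrite gr -EFinM /k exprSr mulrA.
- by apply: (@restr_inv_measurable 1) => x y /label_restr_eq ->.
- by move=> x _; rewrite lee_fin.
Qed.

Lemma integral_level_atom (g : nat * bool -> R) (r : R) (n : nat) (t : mtree) :
  (forall c, 0 <= g c) -> (\int[P]_x (g (label x [::]))%:E = r%:E)%E ->
  (\int[P]_(x in [set x | restr n x = restr n t])
     (\prod_(u <- fset_set (level n t)) g (label x u))%:E =
   \int[P]_(x in [set x | restr n x = restr n t]) (r ^+ Z n t)%:E)%E.
Proof.
move=> g0 gr; rewrite integral_cst; last exact: measurable_atom.
rewrite [X in (_ * X)%E](atom_prob n t) -EFinM mulrC.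
(* With [us1] empty the whole level is still to be revealed, and the constant assignment is a
   placeholder. *)
have := @integral_revealed g r n t _ [::] (fun=> (0%N, false)) g0 gr erefl.
rewrite big_nil mulr1 => <-; congr integral.
by apply/seteqP; split=> x //= -[].
Qed.

(** Branching property in integrated form: the space is cut into the countably many atoms of F_n, on
    each of which [h], the level and [Z n] are constant, so that [integral_level_atom] applies. *)
Lemma integral_level (g : nat * bool -> R) (r : R) (n : nat) (h : mtree -> R) :
  (forall c, 0 <= g c) -> (\int[P]_x (g (label x [::]))%:E = r%:E)%E ->
  (forall x, 0 <= h x) -> restr_inv n h ->
  (\int[P]_x (h x * \prod_(u <- fset_set (level n x)) g (label x u))%:E =
   \int[P]_x (h x * r ^+ Z n x)%:E)%E.
Proof.
move=> g0 gr h0 hn.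
have r0 : 0 <= r by rewrite -lee_fin -gr; apply: integral_ge0 => x _; rewrite lee_fin.
have [code codeI] := countable_injP _ (countable_range_restr n).
have code_eq x y : code (restr n x) = code (restr n y) -> restr n x = restr n y.
  by apply: codeI; rewrite inE; [exists x|exists y].
have mcode i : measurable ((code \o restr n : mtreeF -> nat) @^-1` [set i]).
  by apply: (@F_measurable n); apply/F_P => x y /= ->.
have prod_inv : restr_inv n.+1 (fun x =>
    \prod_(u <- fset_set (level n x)) g (label x u)).
  move=> x y e; rewrite (restr_inv_level (restr_le (leqnSn n) e)).
  apply: eq_big_seq => u; rewrite mem_level inE => -[_ un].
  by rewrite (label_restr_eq e)// un.
rewrite !(@integral_partition _ _ _ P _ (code \o restr n) setT)//; first last.
- by move=> x _; rewrite lee_fin mulr_ge0// prodr_ge0.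
- apply: (@restr_inv_measurable n.+1) => x y e.
  by rewrite (hn _ _ (restr_le (leqnSn n) e)) (prod_inv _ _ e).
- by move=> x _; rewrite lee_fin mulr_ge0// exprn_ge0.
- apply: (@restr_inv_measurable n) => x y e.
  by rewrite (hn _ _ e) (restr_inv_Z e).
apply: eq_esum => i _; rewrite setTI.
(* A number that codes no restricted tree gives an empty cell. *)
have [[t ti]|no] := pselect (exists t, code (restr n t) = i); last first.
  have -> : (code \o restr n) @^-1` [set i] = set0.
    by apply/seteqP; split=> // x xi; apply: no; exists x.
  by rewrite !integral_set0.
have -> : (code \o restr n) @^-1` [set i] = [set x | restr n x = restr n t].
  by apply/seteqP; split=> x /= => [|->//]; rewrite -ti => /code_eq.
have mA := measurable_atom n t.
transitivity ((h t)%:E * \int[P]_(x in [set x | restr n x = restr n t])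
     (\prod_(u <- fset_set (level n t)) g (label x u))%:E)%E.
  rewrite -ge0_integralZl//; first last.
  - by rewrite lee_fin.
  - by move=> x _; rewrite lee_fin prodr_ge0.
  - apply: (eq_measurable_fun (fun x : mtreeF =>
      (\prod_(u <- fset_set (level n x)) g (label x u))%:E)) => //.
      by move=> x; rewrite inE /= => /restr_inv_level ->.
    apply: (@restr_inv_measurable n.+1) => x y e.
    by rewrite (prod_inv _ _ e).
  apply: eq_integral => x; rewrite inE /= => xt.
  by rewrite -EFinM (hn _ _ xt) (restr_inv_level xt).
rewrite (integral_level_atom _ _ g0 gr) -ge0_integralZl//; first last.
- by rewrite lee_fin.
- by move=> x _; rewrite lee_fin exprn_ge0.
apply: eq_integral => x; rewrite inE /= => xt.
by rewrite -EFinM (hn _ _ xt) (restr_inv_Z xt).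
Qed.

(** The last generation enters through a product over the nodes at level n, which is the form
    required by [integral_level] with g(k, eta) = s^eta t^k. *)
Lemma weightS (s t : R) (n : nat) (x : mtree) :
  s ^+ M n.+1 x * t ^+ Z n.+1 x =
  s ^+ M n x * \prod_(u <- fset_set (level n x)) (s ^+ mark x u * t ^+ kids x u).
Proof. by rewrite MS ZS exprD big_split/= !prodrXr mulrA. Qed.

End Step.

(** * Generating function and tilted measure *)

(** Convexity of the power: the slope of the chord from a to t is at most that of the chord from a
    to 1. Clearing denominators covers t = a and a = 1 as well. *)
Lemma expr_chord (R : realDomainType) (a t : R) (k : nat) :
  0 <= a <= 1 -> 0 <= t <= 1 ->
  (1 - a) * `|t ^+ k - a ^+ k| <= `|t - a| * (1 - a ^+ k).
Proof.
move=> /andP[a0 a1] /andP[t0 t1]; elim: k => [|k IH].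
  by rewrite !expr0 !subrr normr0 !mulr0.
have -> : t ^+ k.+1 - a ^+ k.+1 = t * (t ^+ k - a ^+ k) + a ^+ k * (t - a).
  by rewrite !exprS; ring.
have ak0 : 0 <= a ^+ k by exact: exprn_ge0.
apply: (@le_trans _ _ ((1 - a) * (`|t ^+ k - a ^+ k| + a ^+ k * `|t - a|))).
  apply: ler_wpM2l; first lra.
  apply: le_trans (ler_normD _ _) _; rewrite !normrM (ger0_norm t0) (ger0_norm ak0).
  by rewrite lerD2r ler_piMl.
rewrite mulrDr; apply: le_trans (lerD IH (lexx _)) _.
by rewrite exprS le_eqVlt; apply/orP; left; apply/eqP; ring.
Qed.

Lemma density_probability d (T : measurableType d) (R : realType)
    (mu : {measure set T -> \bar R}) (f : T -> \bar R) :
  measurable_fun setT f -> (forall x, 0 <= f x)%E -> (\int[mu]_x f x = 1)%E ->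
  exists Q : probability T R, forall A, Q A = (\int[mu]_(x in A) f x)%E.
Proof.
move=> mf f0 f1; pose nu (A : set T) := (\int[mu]_(x in A) f x)%E.
have nu0 : nu set0 = 0%E by rewrite /nu integral_set0.
have nu_ge0 A : (0 <= nu A)%E by apply: integral_ge0.
have nuS : semi_sigma_additive nu.
  move=> F mF tF mUF; rewrite /nu ge0_integral_bigcup//; last first.
    exact: measurable_funS mf.
  by apply: is_cvg_ereal_nneg_natsum_cond => n _ _; exact: nu_ge0.
pose nuM := isMeasure.Build _ _ _ nu nu0 nu_ge0 nuS.
pose nuT : {measure set T -> \bar R} := HB.pack nu nuM.
pose nuP := Measure_isProbability.Build _ _ _ nuT f1.
pose Q : probability T R := HB.pack nu nuM nuP.
by exists Q.
Qed.

(** * Weighted means and their recursion over generations *)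

Section MarkedGW.
Variables (R : realType) (pi : nat * bool -> R) (P : probability mtreeF R) (s : R).
Hypotheses (pi_ge0 : forall c, 0 <= pi c) (P_mgw : is_mgw pi P) (s01 : 0 < s < 1).

Let s_ge0 : 0 <= s. Proof. by case/andP: s01 => /ltW. Qed.
Let s_le1 : s <= 1. Proof. by case/andP: s01 => _ /ltW. Qed.

Definition weight (L : set mtree) (n : nat) (t : R) (x : mtree) : R :=
  \1_L x * s ^+ M n x * t ^+ Z n x.

Lemma weight_inv (L : set mtree) (n : nat) (t : R) : F_ n L ->
  restr_inv n (weight L n t).
Proof.
move=> FL x y e; rewrite /weight (restr_inv_indic R FL e).
by rewrite (restr_inv_M e) (restr_inv_Z e).
Qed.

Lemma weight01 (L : set mtree) (n : nat) (t : R) (x : mtree) : 0 <= t <= 1 ->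
  0 <= weight L n t x <= 1.
Proof.
move=> /andP[t0 t1]; rewrite !mulr_ge0 ?exprn_ge0//=.
by rewrite !mulr_ile1 ?mulr_ge0 ?exprn_ge0 ?exprn_ile1// indicE lern1 leq_b1.
Qed.

Lemma bounded_integrable (n : nat) (X : mtree -> R) : restr_inv n X ->
  (forall x, 0 <= X x <= 1) -> P.-integrable setT (EFin \o X).
Proof.
move=> Xn X01; apply: measurable_bounded_integrable => //.
- by rewrite [ltLHS]probability_setT ltry.
- exact: restr_inv_measurable Xn.
- exists 1; split; first exact: num_real.
  move=> y y1 x _ /=; have /andP[X0 X1] := X01 x.
  by rewrite ger0_norm// (le_trans X1)// ltW.
Qed.

Lemma weight_integrable (L : set mtree) (n : nat) (t : R) : F_ n L ->
  0 <= t <= 1 -> P.-integrable setT (EFin \o weight L n t).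
Proof.
move=> FL t01; apply: (bounded_integrable (weight_inv t FL)) => x.
exact: weight01.
Qed.

Definition mean (L : set mtree) (n : nat) (t : R) : R := \int[P]_x weight L n t x.

Lemma meanE (L : set mtree) (n : nat) (t : R) : F_ n L -> 0 <= t <= 1 ->
  (\int[P]_x (weight L n t x)%:E = (mean L n t)%:E)%E.
Proof.
by move=> FL t01; rewrite fineK// integrable_fin_num//; exact: weight_integrable.
Qed.

Lemma FT (n : nat) : F_ n setT.
Proof. exact/F_P. Qed.

Local Notation f := (fgen P s).

Lemma fgen_mean (t : R) : f t = mean setT 1 t.
Proof.
rewrite /fgen unlock; congr fine; apply: eq_integral => x _.
by rewrite /weight indicT mul1r.
Qed.

Lemma weight_root (t : R) (x : mtree) :
  weight setT 1 t x = s ^+ (label x [::]).2 * t ^+ (label x [::]).1.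
Proof.
by rewrite /weight indicT mul1r weightS M0 level0 fset_set1 big_seq_fset1 mul1r.
Qed.

Lemma fgenE (t : R) : 0 <= t <= 1 ->
  (\int[P]_x (s ^+ (label x [::]).2 * t ^+ (label x [::]).1)%:E = (f t)%:E)%E.
Proof.
move=> t01; rewrite fgen_mean -meanE//; last exact: FT.
by apply: eq_integral => x _; rewrite weight_root.
Qed.

Lemma fgen_le (t u : R) : 0 <= t <= 1 -> 0 <= u <= 1 -> t <= u -> f t <= f u.
Proof.
move=> t01 u01 tu; rewrite !fgen_mean; apply: le_Rintegral => //;
  [exact/weight_integrable/t01/FT|exact/weight_integrable/u01/FT|].
move=> x _; rewrite /weight indicT mul1r ler_wpM2l ?exprn_ge0//.
by move: t01 u01 => /andP[t0 _] /andP[u0 _]; apply: lerXn2r; rewrite ?nnegrE.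
Qed.

(** Integrates [expr_chord] with exponent [Z 1] against the nonnegative factor s^M_1; the chord
    inequality passes from powers to f. *)
Lemma fgen_chord (a t : R) : 0 <= a <= 1 -> 0 <= t <= 1 ->
  (1 - a) * `|f t - f a| <= `|t - a| * (f 1 - f a).
Proof.
move=> a01 t01; have o01 : 0 <= (1 : R) <= 1 by rewrite ler01 lexx.
have iW u : 0 <= u <= 1 -> P.-integrable setT (EFin \o weight setT 1 u).
  by apply: weight_integrable; exact: FT.
have iD u v : 0 <= u <= 1 -> 0 <= v <= 1 ->
    P.-integrable setT (EFin \o (fun x => weight setT 1 u x - weight setT 1 v x)).
  move=> u01 v01; rewrite (_ : _ \o _ =
    ((EFin \o weight setT 1 u) \- (EFin \o weight setT 1 v))%E)//.
  by apply: integrableB => //; exact: iW.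
rewrite !fgen_mean /mean -!RintegralB//; try exact: iW.
have a1 : 0 <= 1 - a by case/andP: a01; rewrite subr_ge0.
apply: (@le_trans _ _ ((1 - a) * \int[P]_x `|weight setT 1 t x - weight setT 1 a x|)).
  by apply: ler_wpM2l => //; apply: le_normr_Rintegral => //; exact: iD.
have iN : P.-integrable setT (EFin \o (fun x => `|weight setT 1 t x - weight setT 1 a x|)).
  rewrite (_ : _ \o _ = fun x => `|(weight setT 1 t x - weight setT 1 a x)%:E|%E)//.
  exact/integrable_abse/iD.
have iZ (c : R) (X : mtree -> R) : P.-integrable setT (EFin \o X) ->
    P.-integrable setT (EFin \o (fun x => c * X x)).
  move=> iX; rewrite (_ : _ \o _ = fun x => (c%:E * (X x)%:E)%E)//.
  exact: integrableZl.
rewrite -!RintegralZl//; last exact: iD.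
apply: le_Rintegral => //; [exact: iZ|exact/iZ/iD|].
move=> x _; rewrite /weight expr1n -!mulrBr normrM.
set c := \1__ _ * _; have c0 : 0 <= c by rewrite mulr_ge0// exprn_ge0.
rewrite (ger0_norm c0) mulrCA [leRHS]mulrCA ler_wpM2l//.
exact: expr_chord.
Qed.

(** One generation is integrated out by [integral_level] with g(k, eta) = s^eta t^k, whose mean at
    the root is f(t). *)
Lemma mean_step (L : set mtree) (n : nat) (t : R) : F_ n L -> 0 <= t <= 1 ->
  mean L n.+1 t = mean L n (f t).
Proof.
move=> FL t01; congr fine; have /andP[t0 _] := t01.
have := @integral_level R pi P pi_ge0 P_mgw
  (fun c => s ^+ c.2 * t ^+ c.1) (f t) n (fun x => \1_L x * s ^+ M n x).
move=> <-; first last.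
- by move=> x y e; rewrite (restr_inv_indic R FL e) (restr_inv_M e).
- by move=> x; rewrite mulr_ge0 ?exprn_ge0.
- exact: fgenE.
- by move=> c; rewrite mulr_ge0 ?exprn_ge0.
by apply: eq_integral => x _; rewrite /weight -!mulrA weightS.
Qed.

Lemma mean_T0 (t : R) : mean setT 0 t = t.
Proof.
rewrite /mean (_ : weight setT 0 t = cst t).
  by rewrite Rintegral_cst// [X in fine X]probability_setT mulr1.
by apply/funext => x; rewrite /weight indicT M0 Z0 !mul1r.
Qed.

(** * Fixed point and iterates of the generating function *)

Hypothesis (f0_gt0 : 0 < f 0) (f1_lt1 : f 1 < 1).

Let i0 : 0 <= (0 : R) <= 1. Proof. by rewrite lexx ler01. Qed.
Let i1 : 0 <= (1 : R) <= 1. Proof. by rewrite ler01 lexx. Qed.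

Lemma fgen01 (t : R) : 0 <= t <= 1 -> 0 <= f t <= 1.
Proof.
move=> t01; have /andP[t0 t1] := t01; apply/andP; split.
  exact/(le_trans (ltW f0_gt0))/fgen_le.
exact/(le_trans _ (ltW f1_lt1))/fgen_le.
Qed.

Lemma iter_fgen01 (m : nat) (t : R) : 0 <= t <= 1 -> 0 <= iter m f t <= 1.
Proof. by move=> t01; elim: m => //= m; exact: fgen01. Qed.

Lemma mean_iter (L : set mtree) (n m : nat) (t : R) : F_ n L -> 0 <= t <= 1 ->
  mean L (n + m) t = mean L n (iter m f t).
Proof.
move=> FL; elim: m t => [|m IH] t t01; first by rewrite addn0.
rewrite addnS mean_step//; last by apply: F_le FL; rewrite leq_addr.
by rewrite IH ?iterSr//; exact: fgen01.
Qed.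

(* Knaster-Tarski: the monotone map f has a fixed point without any appeal to
   its continuity. *)
Lemma fgen_fixpoint : exists2 k : R, 0 < k < 1 & f k = k.
Proof.
pose E : set R := [set t | 0 <= t <= 1 /\ t <= f t].
have E0 : E 0 by split=> //; exact: ltW.
have supE : has_sup E by split; [exists 0|exists 1 => t [/andP[]]].
have ubE := sup_upper_bound supE.
set k := sup E in ubE.
have k01 : 0 <= k <= 1.
  by rewrite ubE//=; apply: ge_sup; [exists 0|move=> t [/andP[]]].
have kf : k <= f k.
  apply: ge_sup; first by exists 0.
  move=> t Et; have [t01 tf] := Et; apply: le_trans tf _.
  by apply: fgen_le => //; exact: ubE.
have fk : f k = k.
  apply/eqP; rewrite eq_le kf andbT; apply: ubE; split; first exact: fgen01.
  by apply: fgen_le => //; exact: fgen01.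
have /andP[k0 k1] := k01.
(* Monotonicity gives 0 < f(0) <= f(k) = k and k = f(k) <= f(1) < 1. *)
exists k => //; rewrite -fk (lt_le_trans f0_gt0) ?(le_lt_trans _ f1_lt1)//;
  exact: fgen_le.
Qed.

Variable k : R.
Hypotheses (k01 : 0 < k < 1) (fk : f k = k).

Let k_gt0 : 0 < k. Proof. by case/andP: k01. Qed.
Let k_lt1 : k < 1. Proof. by case/andP: k01. Qed.
Let ik : 0 <= k <= 1. Proof. by rewrite !ltW. Qed.

(** The slope of the chord of f from k to 1, used as contraction ratio towards k; it is less than 1
    because f(1) < 1. *)
Let r : R := (f 1 - k) / (1 - k).

Let r01 : 0 <= r < 1.
Proof.
have f1k : k <= f 1 by rewrite -{1}fk; apply: fgen_le => //; exact: ltW.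
apply/andP; split; first by rewrite divr_ge0// subr_ge0// ltW.
by rewrite ltr_pdivrMr ?subr_gt0// mul1r ltrD2r.
Qed.

Let fgen_contract (t : R) : 0 <= t <= 1 -> `|f t - k| <= r * `|t - k|.
Proof.
move=> t01; have := fgen_chord ik t01; rewrite fk => h.
by rewrite /r mulrAC ler_pdivlMr ?subr_gt0// mulrC [leRHS]mulrC.
Qed.

(** A fixed point t satisfies |t - k| <= r |t - k| with r < 1. *)
Lemma fgen_fixpoint_uniq (t : R) : 0 <= t <= 1 -> f t = t -> t = k.
Proof.
move=> t01 ft; have := fgen_contract t01; rewrite ft => h.
apply/eqP; rewrite -subr_eq0 -normr_le0.
have /andP[r0 r1] := r01; have := normr_ge0 (t - k); nra.
Qed.

Lemma iter_fgen_cvg (t : R) : 0 <= t <= 1 -> iter m f t @[m --> \oo] --> k.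
Proof.
move=> t01; have /andP[r0 r1] := r01.
have bound m : `|iter m f t - k| <= r ^+ m * `|t - k|.
  elim: m => [|m IH]; first by rewrite expr0 mul1r.
  rewrite iterS exprS -mulrA; apply: le_trans (fgen_contract (iter_fgen01 m t01)) _.
  exact: ler_wpM2l.
have r_cvg : r ^+ m * `|t - k| @[m --> \oo] --> 0.
  rewrite -(mul0r `|t - k|); apply: cvgM; last exact: cvg_cst.
  by apply: cvg_expr; rewrite ger0_norm.
apply: (@squeeze_cvgr _ _ _ _ (fun m => k - r ^+ m * `|t - k|)
  (fun m => k + r ^+ m * `|t - k|)).
- apply: nearW => m; have := bound m; rewrite ler_norml; lra.
- by rewrite -[X in _ --> X]subr0; apply: cvgB => //; exact: cvg_cst.
- by rewrite -[X in _ --> X]addr0; apply: cvgD => //; exact: cvg_cst.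
Qed.

(** By [mean_iter] only the argument f^m(t) moves, while L, M_n and Z_n stay fixed; dominated
    convergence applies with the bound 1. *)
Lemma mean_cvg (L : set mtree) (n : nat) (t : R) : F_ n L -> 0 <= t <= 1 ->
  mean L (n + m) t @[m --> \oo] --> mean L n k.
Proof.
move=> FL t01.
under eq_fun do rewrite mean_iter//.
apply: fine_cvg; rewrite -/(mean L n k) -meanE//.
have mw u : measurable_fun setT (fun x : mtreeF => (weight L n u x)%:E).
  by apply: (@restr_inv_measurable n) => x y /(weight_inv u FL) ->.
have [|||_ _ //] := @dominated_convergence _ mtreeF R P setT measurableT
  (fun m x => (weight L n (iter m f t) x)%:E)
  (fun x => (weight L n k x)%:E) (cst 1%E) (fun m => mw _) (mw k).
- apply: aeW => x _; apply: cvg_EFin; first by apply: nearW => m.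
  apply: cvgM; first exact: cvg_cst.
  elim: (Z n x) => [|z IH]; first exact: cvg_cst.
  by rewrite exprS; under eq_fun do rewrite exprS; apply: cvgM => //; exact: iter_fgen_cvg.
- exact: finite_measure_integrable_cst.
- apply: aeW => x m _; have /andP[w0 w1] := weight01 L n x (iter_fgen01 m t01).
  by rewrite gee0_abs lee_fin.
Qed.

(** * Tilted means and the density of the tilted measure *)

Lemma mean_div (L : set mtree) (n : nat) (t : R) : F_ n L -> 0 <= t <= 1 ->
  (\int[P]_x (weight L n t x / k)%:E = (mean L n t / k)%:E)%E.
Proof.
move=> FL t01; rewrite mulrC EFinM -meanE// -ge0_integralZl//; first last.
- by rewrite lee_fin invr_ge0 ltW.
- by move=> x _; rewrite lee_fin; have /andP[] := weight01 L n x t01.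
- by apply: (@restr_inv_measurable n) => x y /(weight_inv t FL) ->.
by apply: eq_integral => x _; rewrite -EFinM mulrC.
Qed.

Lemma tilted_meanE (L : set mtree) (n : nat) : F_ n L ->
  tilted_mean P s k n L = (mean L n k / k)%:E.
Proof.
move=> FL; rewrite /tilted_mean unlock -mean_div//.
apply: eq_integral => x _; congr EFin.
by rewrite expfzDr ?gt_eqF// mulrA.
Qed.

(* The martingale limit: on the extinction event, where Z m vanishes from some
   time on, weight setT m 0 is eventually equal to s ^+ M m; elsewhere it is 0. *)
Definition density (x : mtree) : \bar R :=
  limn (fun m => (weight setT m 0 x / k)%:E).

(** The factor 0^Z_m is the indicator of extinction by time m. Before extinction the weight is 0;
    afterwards the levels are empty, so M and Z no longer change. *)
Lemma weight0_nd (x : mtree) :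
  nondecreasing_seq (fun m => (weight setT m 0 x / k)%:E).
Proof.
apply/nondecreasing_seqP => m; rewrite lee_fin ler_pM2r ?invr_gt0//.
have [Zx|Zx] := eqVneq (Z m x) 0%N; last first.
  rewrite {1}/weight expr0n (negbTE Zx) mulr0.
  by have /andP[] := weight01 setT m.+1 x i0.
have lev0 : fset_set (level m x) = fset0 by apply/cardfs0_eq.
by rewrite /weight MS ZS Zx lev0 !big_seq_fset0 addn0.
Qed.

Lemma density_ge0 (x : mtree) : (0 <= density x)%E.
Proof.
apply: lime_ge; first exact/ereal_nondecreasing_is_cvgn/weight0_nd.
apply: nearW => m; rewrite lee_fin divr_ge0 ?(ltW k_gt0)//.
by have /andP[] := weight01 setT m x i0.
Qed.

Lemma measurable_density : measurable_fun setT (density : mtreeF -> \bar R).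
Proof.
apply: (@emeasurable_fun_cvg _ mtreeF R setT
  (fun m (x : mtreeF) => (weight setT m 0 x / k)%:E)).
  move=> m; apply: (@restr_inv_measurable m) => x y e.
  by rewrite (weight_inv 0 (FT m) e).
by move=> x _; exact/ereal_nondecreasing_is_cvgn/weight0_nd.
Qed.

Lemma integral_density (L : set mtree) (n : nat) : F_ n L ->
  (\int[P]_(x in L) density x = (mean L n k / k)%:E)%E.
Proof.
move=> FL.
pose w m x := (weight setT m 0 x / k)%:E.
have w_cvg : (\int[P]_(x in L) w m x)%E @[m --> \oo] --> (\int[P]_(x in L) density x)%E.
  apply: cvg_monotone_convergence => //.
  - exact: F_measurable FL.
  - move=> m; apply: (@restr_inv_measurable m) => x y e.
    by rewrite /w (weight_inv 0 (FT m) e).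
  - move=> m x _; rewrite lee_fin divr_ge0 ?(ltW k_gt0)//.
    by have /andP[] := weight01 setT m x i0.
  - by move=> x _; exact: weight0_nd.
have w_mean m : (\int[P]_(x in L) w (m + n)%N x)%E = (mean L (n + m) 0 / k)%:E.
  have FL' : F_ (n + m) L by apply: F_le FL; rewrite leq_addr.
  (* Integrating over [L] turns [weight setT] into [weight L]. *)
  rewrite -mean_div// integral_mkcond addnC; apply: eq_integral => x _.
  rewrite /w /weight patchE indicT indicE.
  by case: ifP => _; rewrite ?mul1r// !mul0r.
(* The indices start at n, so that [L] belongs to each F_(n+m) and [mean_cvg] applies at t = 0. *)
rewrite -(cvg_shiftn n) in w_cvg.
have {}w_cvg : (mean L (n + m) 0 / k)%:E @[m --> \oo] -->
    (\int[P]_(x in L) density x)%E.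
  by under eq_fun do rewrite -w_mean.
apply: cvg_unique w_cvg _ => //.
apply: cvg_EFin; first exact: nearW.
by apply: cvgM; [exact: mean_cvg|exact: cvg_cst].
Qed.

(** Each node of length below n is replaced by its k_u children in the next generation, so the
    numbers k_u - 1 add up to Z_n - Z_0 = Z_n - 1. *)
Lemma tilt_prod (n : nat) (t : mtree) :
  \big[*%R/1]_(u \in inner n t)
    (s ^+ (label t u).2 * k ^ ((label t u).1%:Z - 1)) =
  s ^+ M n t * k ^ ((Z n t)%:Z - 1).
Proof.
elim: n => [|n IH]; first by rewrite inner0 fsbig_set0 M0 Z0 mul1r.
rewrite big_innerS IH big_split/= prodrXr MS exprD mulrACA; congr (_ * _).
have k0 : k != 0 by rewrite gt_eqF.
have -> : forall r : seq (seq nat), \prod_(u <- r) k ^ ((kids t u)%:Z - 1) =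
    k ^ ((\sum_(u <- r) kids t u)%:Z - (size r)%:Z).
  elim=> [|u v IHv]; first by rewrite !big_nil.
  by rewrite !big_cons IHv -expfzDr//= PoszD intS; congr (_ ^ _); ring.
by rewrite -expfzDr// ZS; congr (_ ^ _); rewrite /Z; ring.
Qed.

(** On an atom of F_n both M_n and Z_n are constant, so the mean is a constant times the probability
    of the atom; [tilt_prod] distributes that constant over the nodes. This yields [is_mgw] for the
    tilted measure. *)
Lemma mean_atom (n : nat) (t : mtree) :
  mean [set x | restr n x = restr n t] n k / k =
  \big[*%R/1]_(u \in inner n t)
    (pi (label t u) * s ^+ (label t u).2 * k ^ ((label t u).1%:Z - 1)).
Proof.
set A := [set x | _].
have FA : F_ n A by exact: F_atom.
transitivity (s ^+ M n t * k ^ ((Z n t)%:Z - 1) *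
  \big[*%R/1]_(u \in inner n t) pi (label t u)).
  apply: EFin_inj; rewrite -mean_div// EFinM -(atom_prob P_mgw) -/A.
  transitivity (\int[P]_(x in A) (s ^+ M n t * k ^ ((Z n t)%:Z - 1))%:E)%E.
    rewrite [RHS]integral_mkcond; apply: eq_integral => x _.
    rewrite patchE /weight indicE; case: ifPn => [|_]; last by rewrite !mul0r.
    rewrite inE => e; rewrite mul1r (restr_inv_M e) (restr_inv_Z e).
    by rewrite expfzDr ?gt_eqF// mulrA.
  by rewrite integral_cst//; exact: F_measurable FA.
rewrite -tilt_prod !fsbig_finite//; try exact: finite_inner.
rewrite -big_split/=; apply: eq_bigr => u _; ring.
Qed.

(** The total mass is f(k) / k, which is 1 exactly because k is a fixed point. *)
Lemma tilted_distribution :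
  (\esum_(c in [set: nat * bool]) (pi c * s ^+ c.2 * k ^ (c.1%:Z - 1))%:E = 1)%E.
Proof.
transitivity (\esum_(c in [set: nat * bool])
    (pi c * (s ^+ c.2 * k ^ (c.1%:Z - 1)))%:E)%E.
  by apply: eq_esum => c _; rewrite mulrA.
have k0 := ltW k_gt0.
rewrite -(integral_root_label P_mgw); last first.
  by move=> c; rewrite mulr_ge0 ?exprn_ge0 ?exprz_ge0.
transitivity ((mean setT 1 k / k)%:E); last by rewrite -fgen_mean fk divff ?gt_eqF.
rewrite -mean_div//; last exact: FT.
by apply: eq_integral => x _; rewrite weight_root expfzDr ?gt_eqF// mulrA.
Qed.

End MarkedGW.

(** * Strict bounds for the generating function at 0 and 1 *)

Section Generating.
Variables (R : realType) (pi : nat * bool -> R) (P : probability mtreeF R) (s : R).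
Hypotheses (P_mgw : is_mgw pi P) (s01 : 0 < s < 1).

Let esum_ge_term (a : nat * bool -> R) (c : nat * bool) :
  ((a c)%:E <= \esum_(c in [set: nat * bool]) (a c)%:E)%E.
Proof.
by apply: esum_ge; exists [set c]; rewrite ?fsbig_set1//; split.
Qed.

(** Since 0^0 = 1, the label (0, b) contributes the positive term pi(0, b) s^b to f(0). *)
Lemma fgen0_gt0 (b : bool) : 0 < pi (0%N, b) -> 0 < fgen P s 0.
Proof.
move=> pb; rewrite -lte_fin -(fgenE P s01); last by rewrite lexx ler01.
have s0 : 0 < s by case/andP: s01.
rewrite (integral_root_label (g := fun c => s ^+ c.2 * 0 ^+ c.1) P_mgw); last first.
  by move=> c; rewrite mulr_ge0 ?exprn_ge0// ltW.
apply: lt_le_trans (esum_ge_term (fun c => pi c * (s ^+ c.2 * 0 ^+ c.1)) (0%N, b)).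
by rewrite lte_fin mulr1 mulr_gt0// exprn_gt0.
Qed.

(** The defect 1 - f(1) is the mean of 1 - s^M_1, in which the label (j, 1) contributes the positive
    term pi(j, 1) (1 - s). *)
Lemma fgen1_lt1 (j : nat) : 0 < pi (j, true) -> fgen P s 1 < 1.
Proof.
move=> pj; have /andP[s0 s1] := s01.
have mlab (g : nat * bool -> R) :
    measurable_fun setT (fun x : mtreeF => (g (label x [::]))%:E).
  by apply: (@restr_inv_measurable 1) => x y /label_restr_eq ->.
have g0 (c : nat * bool) : 0 <= s ^+ c.2 * 1 ^+ c.1.
  by rewrite expr1n mulr1 exprn_ge0 ?ltW.
have g1 (c : nat * bool) : 0 <= 1 - s ^+ c.2 * 1 ^+ c.1.
  by rewrite expr1n mulr1 subr_ge0 exprn_ile1 ?ltW.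
have defect_gt0 : (0 < \int[P]_x (1 - s ^+ (label x [::]).2 * 1 ^+ (label x [::]).1)%:E)%E.
  rewrite (integral_root_label P_mgw g1).
  apply: lt_le_trans (esum_ge_term (fun c => pi c * (1 - s ^+ c.2 * 1 ^+ c.1)) (j, true)).
  by rewrite lte_fin/= expr1n mulr1 mulr_gt0// subr_gt0.
have sum1 : ((fgen P s 1)%:E +
    \int[P]_x (1 - s ^+ (label x [::]).2 * 1 ^+ (label x [::]).1)%:E = 1)%E.
  rewrite -(fgenE P s01); last by rewrite lexx ler01.
  rewrite -ge0_integralD//; first last.
  - exact: (mlab (fun c => 1 - s ^+ c.2 * 1 ^+ c.1)).
  - by move=> x _; rewrite lee_fin.
  - exact: (mlab (fun c => s ^+ c.2 * 1 ^+ c.1)).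
  - by move=> x _; rewrite lee_fin.
  rewrite (eq_integral (cst 1%E)); last by move=> x _; rewrite -EFinD addrC subrK.
  by rewrite integral_cst// mul1e; exact: probability_setT.
rewrite -lte_fin -sum1 lteDl//.
Qed.

End Generating.

Theorem theorem4p1 (R : realType) (p q : nat -> R) (P : probability mtreeF R)
  (s : R)
  (p_distr : is_distribution p)
  (p01 : p 0%N + p 1%N < 1)
  (p_mean : (\esum_(k in [set: nat]) (k%:R * p k)%:E < +oo)%E)
  (p0_gt0 : 0 < p 0%N)
  (q_mark : forall k, 0 <= q k <= 1)
  (pq_gt0 : exists k, 0 < p k * q k)
  (P_mgw : is_mgw (mark_law p q) P)
  (s01 : 0 < s < 1) :
  exists kappa : R,
    unique (fun t => 0 <= t <= 1 /\ fgen P s t = t) kappa /\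
    (forall (t : R) (n : nat) (L : set mtree), 0 <= t <= 1 -> F_ n L ->
       fine 'E_P[fun x => \1_L x * s ^+ M (n + m) x * t ^+ Z (n + m) x] /
       fine 'E_P[fun x => s ^+ M (n + m) x * t ^+ Z (n + m) x]
         @[m --> \oo] --> fine (tilted_mean P s kappa n L)) /\
    exists Q : probability mtreeF R,
      [/\ (forall n L, F_ n L -> Q L = tilted_mean P s kappa n L),
          (forall Q' : probability mtreeF R,
             (forall n L, F_ n L -> Q' L = tilted_mean P s kappa n L) ->
             forall A : set mtreeF, measurable A -> Q' A = Q A),
          is_distribution (tilted_law p q s kappa) &
          is_mgw (tilted_law p q s kappa) Q].
Proof.
have p_ge0 : forall i, 0 <= p i by case: p_distr.
have pi_ge0 c : 0 <= mark_law p q c.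
  have /andP[q0 q1] := q_mark c.1.
  by rewrite /mark_law mulr_ge0//; case: c.2; rewrite ?subr_ge0.
have f0_gt0 : 0 < fgen P s 0.
  (* A childless root has positive probability, hence so does at least one of its two marks. *)
  have [q0|q0] := ltP 0 (q 0%N).
    by apply: (fgen0_gt0 P_mgw s01 (b := true)); exact: mulr_gt0.
  apply: (fgen0_gt0 P_mgw s01 (b := false)).
  by apply: mulr_gt0 => //=; rewrite subr_gt0 (le_lt_trans q0).
have f1_lt1 : fgen P s 1 < 1.
  by have [j pqj] := pq_gt0; exact: (fgen1_lt1 P_mgw s01 (j := j)).
have [k k01 fk] := fgen_fixpoint s01 f0_gt0 f1_lt1.
have /andP[k0 k1] := k01.
have ik : 0 <= k <= 1 by rewrite !ltW.
have tiltE n L : F_ n L -> tilted_mean P s k n L = (mean P s L n k / k)%:E.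
  by move=> FL; rewrite (tilted_meanE P s01 k01 FL).
exists k; split; last split.
- split=> // t [t01 ft].
  exact/esym/(fgen_fixpoint_uniq s01 f1_lt1 k01 fk).
- move=> t n L t01 FL.
  have num m : fine 'E_P[fun x => \1_L x * s ^+ M (n + m) x * t ^+ Z (n + m) x] =
      mean P s L (n + m) t by rewrite unlock.
  have den m : fine 'E_P[fun x => s ^+ M (n + m) x * t ^+ Z (n + m) x] =
      mean P s setT (n + m) t.
    rewrite unlock; congr fine; apply: eq_integral => x _.
    by rewrite /weight indicT mul1r.
  under eq_fun do rewrite num den.
  rewrite tiltE//=; apply: cvgM.
    exact: (mean_cvg pi_ge0 P_mgw s01 f0_gt0 f1_lt1 k01 fk FL t01).
  apply: cvgV; first by rewrite gt_eqF.
  (* The denominator tends to the mean of s^M_n k^Z_n over the whole space, which is the n-th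
     iterate of f at its fixed point k. *)
  have -> : k = mean P s setT n k.
    have := mean_iter pi_ge0 P_mgw s01 f0_gt0 f1_lt1 n (FT 0) ik.
    by rewrite add0n mean_T0 iter_fix.
  exact: (mean_cvg pi_ge0 P_mgw s01 f0_gt0 f1_lt1 k01 fk (FT n) t01).
have intd := integral_density pi_ge0 P_mgw s01 f0_gt0 f1_lt1 k01 fk.
have [Q QE] : exists Q : probability mtreeF R,
    forall A, Q A = (\int[P]_(x in A) density s k x)%E.
  apply: density_probability.
  - exact: measurable_density.
  - by move=> x; exact: density_ge0.
  (* The whole space lies in F_0, where Z_0 = 1 and M_0 = 0, so the total mass is k / k. *)
  - by rewrite (intd _ _ (FT 0)) mean_T0 divff// gt_eqF.
have QF n L : F_ n L -> Q L = tilted_mean P s k n L.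
  by move=> FL; rewrite QE (intd _ n)// tiltE.
exists Q; split=> //.
- move=> Q' Q'F A mA.
  (* The union of the increasing F_n is stable under intersection, generates the sigma-field and
     contains the whole space, which has finite mass. *)
  apply: (@measure_unique _ R mtreeF (\bigcup_n F_ n) (fun=> setT) _ _ _ _ Q' Q) => //.
  + move=> B C [n _ FB] [m _ FC]; exists (maxn n m) => //.
    by apply: F_setI; [apply: F_le FB|apply: F_le FC]; rewrite (leq_maxl, leq_maxr).
  + by move=> _; exists 0%N => //; exact: FT.
  + by apply/seteqP; split=> // x _; exists 0%N.
  + by move=> B [n _ FB]; exact: (etrans (Q'F n B FB) (esym (QF n B FB))).
  + by move=> _; rewrite [ltLHS]probability_setT ltry.
- split; last exact: (tilted_distribution P_mgw s01 k01 fk).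
  move=> c; have s0 : 0 <= s by case/andP: s01 => /ltW.
  rewrite /tilted_law; apply: mulr_ge0; last exact/exprz_ge0/ltW.
  by apply: mulr_ge0; [exact: pi_ge0|exact: exprn_ge0].
- move=> h t _; rewrite (QF h); last exact: F_atom.
  rewrite tiltE; last exact: F_atom.
  by rewrite (mean_atom P_mgw s01 k01).
Qed.
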